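(* Let $\theta\in[\tfrac12,1]$, $\tau>0$, $\epsilon>0$, $\beta>0$, $S_1>0$, $S_2>0$, and let $(\phi^n)_{n\ge 0}$ (functions on $\Omega$) and $(r^n)_{n\ge0}$ (real numbers) be a solution of the $\mathcal U_L$-method, i.e. for every $n\ge 1$, $$D_\tau^\theta\phi^{n+\theta}=\nabla\cdot\big(M^{*,n+\theta}\nabla\mu^{n+\theta}\big),$$ $$\mu^{n+\theta}=H^{*,n+\theta}r^{n+\theta}+\beta\Delta^2\phi^{n+\theta}+\frac{S_1}{\epsilon^2}(\phi^{n+1}-2\phi^n+\phi^{n-1})-S_2\Delta(\phi^{n+1}-2\phi^n+\phi^{n-1}),$$ $$D_\tau^\theta r^{n+\theta}=\frac12\int_\Omega H^{*,n+\theta}\,D_\tau^\theta\phi^{n+\theta}\,d\Omega .$$ Then the method is unconditionally energy stable (no restriction on $\tau$): for every $n\ge1$, $$\frac1\tau\big(\mathcal E_L^{n+1}-\mathcal E_L^{n}\big)\le-\Big\|\sqrt{M^{*,n+\theta}}\,\nabla\mu^{n+\theta}\Big\|^2\le 0,$$ where $$\mathcal E_L^{n+1}=\left|\begin{bmatrix} r^{n+1}\\ r^n\end{bmatrix}\right|_G^2+\frac\beta2\left\|\begin{bmatrix}\Delta\phi^{n+1}\\ \Delta\phi^n\end{bmatrix}\right\|_G^2+\frac{S_1}{\epsilon^2}\frac{\|\phi^{n+1}-\phi^n\|^2}{2}+S_2\frac{\|\nabla\phi^{n+1}-\nabla\phi^n\|^2}{2}.$$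
   Context: $\Omega\subset\mathbb R^d$ ($d=2,3$) is a bounded domain; all functions satisfy periodic boundary conditions (so integration by parts produces no boundary terms) and are sufficiently regular that all expressions below are well defined. $(\cdot,\cdot)$ and $\|\cdot\|$ are the $L^2(\Omega)$ inner product and norm. Anisotropic quantities: $\mathbf n=\nabla\phi/|\nabla\phi|$, $\gamma(\mathbf n)=1+\alpha\big(4\sum_{i=1}^d n_i^4-3\big)$ with $\alpha\ge0$, $F(\phi)=\frac14(\phi^2-1)^2$, $f(\phi)=F'(\phi)=\phi(\phi^2-1)$, $$\mathbf m=\gamma(\mathbf n)\nabla\phi+\frac{\mathbb P\nabla_{\mathbf n}\gamma(\mathbf n)}{|\nabla\phi|}\Big(\tfrac12|\nabla\phi|^2+\tfrac1{\epsilon^2}F(\phi)\Big),\qquad \mathbb P=\mathbb I-\mathbf n\mathbf n^T .$$ The mobility $M(\phi)\ge M_0>0$ is a function of $\phi$ or a constant. $$H(\phi)=\frac{\frac1{\epsilon^2}\gamma(\mathbf n)f(\phi)-\nabla\cdot\mathbf m}{\sqrt{\int_\Omega\gamma(\mathbf n)\big(\frac12|\nabla\phi|^2+\frac1{\epsilon^2}F(\phi)\big)d\Omega+C}},$$ where $C>0$ is a constant making the radicand positive. Time discretization with uniform step $\tau$: for any sequence $(u^n)$, $$D_\tau^\theta u^{n+\theta}=\frac{(\theta+\frac12)u^{n+1}-2\theta u^n+(\theta-\frac12)u^{n-1}}{\tau},\quad u^{n+\theta}=\theta u^{n+1}+(1-\theta)u^n$$ (the latter convention used for $\phi^{n+\theta}$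 and $r^{n+\theta}$; $\mu^{n+\theta}$ is the function defined by the second equation of the scheme), $\phi^{*,n+\theta}=(1+\theta)\phi^n-\theta\phi^{n-1}$, $H^{*,n+\theta}=H(\phi^{*,n+\theta})$, $M^{*,n+\theta}=M(\phi^{*,n+\theta})$. $G$-norms: for $u,w\in L^2(\Omega)$, $$\left\|\begin{bmatrix}u\\ w\end{bmatrix}\right\|_G^2=\frac{\theta(2\theta+3)}2\|u\|^2-(\theta+1)(2\theta-1)(u,w)+\frac{\theta(2\theta-1)}2\|w\|^2,$$ and for real numbers $u,w$, $\left|\begin{bmatrix}u\\ w\end{bmatrix}\right|_G^2$ is given by the same formula with products of reals in place of inner products. *)

(* Defs.v *)
From HB Require Import structures.
From mathcomp Require Import all_boot all_order all_algebra.
From mathcomp Require Import all_classical all_reals all_analysis.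

Set Implicit Arguments.
Unset Strict Implicit.
Unset Printing Implicit Defensive.

Import Order.TTheory GRing.Theory Num.Theory.
Import numFieldNormedType.Exports.

Local Open Scope classical_set_scope.
Local Open Scope ring_scope.

(** ** d-dimensional Lebesgue measure

The library has a product sigma-algebra on [d.-tuple R] but no Lebesgue measure
on it. We build it by transporting [lebesgue_measure \x lebesgue_tuple d] along
[(x, t) |-> x :: t]. *)

Section cons_measure.
Context {disp : measure_display} {T : measurableType disp} {R : realType}.
Variables (n : nat) (m : {sigma_finite_measure set T -> \bar R}).
Variable (nu : {sigma_finite_measure set (n.-tuple T) -> \bar R}).

Definition tuple_cons (p : T * n.-tuple T) : n.+1.-tuple T :=
  [tuple of p.1 :: p.2].

Lemma measurable_tuple_cons : measurable_fun setT tuple_cons.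
Proof.
by apply: (@measurable_cons _ _ _ _ fst n snd);
  [exact: measurable_fst | exact: measurable_snd].
Qed.

Definition cons_measure : set (n.+1.-tuple T) -> \bar R :=
  pushforward (m \x nu)%E tuple_cons.

Let cons_measure0 : cons_measure set0 = 0%E.
Proof. by rewrite /cons_measure /pushforward preimage_set0 measure0. Qed.

Let cons_measure_ge0 A : (0 <= cons_measure A)%E.
Proof. by apply: (measure_ge0 (m \x nu)%E). Qed.

Let cons_measure_sigma_additive : semi_sigma_additive cons_measure.
Proof.
move=> F mF tF mUF; rewrite /cons_measure /pushforward preimage_bigcup.
apply: measure_semi_sigma_additive.
- by move=> k; rewrite -[X in measurable X]setTI; exact: measurable_tuple_cons.
- apply/trivIsetP => i j _ _ ij; rewrite -preimage_setI.
  by move/trivIsetP : tF => /(_ _ _ _ _ ij) ->//; rewrite preimage_set0.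
- by rewrite -preimage_bigcup -[X in measurable X]setTI;
    exact: measurable_tuple_cons.
Qed.

HB.instance Definition _ := isMeasure.Build _ _ _ cons_measure
  cons_measure0 cons_measure_ge0 cons_measure_sigma_additive.

Let cons_measure_sigma_finite : sigma_finite setT cons_measure.
Proof.
have /sigma_finiteP[F [FT ndF Foo]] := sigma_finiteT m.
have /sigma_finiteP[G [GT ndG Goo]] := sigma_finiteT nu.
pose unc (t : n.+1.-tuple T) : T * n.-tuple T := (thead t, [tuple of behead t]).
have uncK p : unc (tuple_cons p) = p.
  by case: p => x t; congr pair; exact: val_inj.
have munc : measurable_fun setT unc.
  by apply: measurable_fun_pair;
    [exact: measurable_tnth | exact: measurable_behead].
exists (fun k => unc @^-1` (F k `*` G k)).
  rewrite -preimage_bigcup (_ : \bigcup_k _ = setT)//.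
  rewrite -setXTT FT GT predeqE => -[x y]; split.
    by move=> [k _ []/= ? ?]; split; exists k.
  move=> [/= [i _ Fx] [j _ Gy]]; exists (maxn i j) => //; split.
  - by move: x Fx; exact/subsetPset/ndF/leq_maxl.
  - by move: y Gy; exact/subsetPset/ndG/leq_maxr.
move=> k; have [mF Fk] := Foo k; have [mG Gk] := Goo k; split.
  by rewrite -[X in measurable X]setTI; apply: munc => //; exact: measurableX.
rewrite /cons_measure /pushforward (_ : _ @^-1` _ = F k `*` G k).
  by rewrite product_measure1E// lte_mul_pinfty// ge0_fin_numE.
rewrite -[RHS]preimage_id -(_ : unc \o tuple_cons = id) ?comp_preimage//.
exact/funext.
Qed.

HB.instance Definition _ :=
  Measure_isSigmaFinite.Build _ _ _ cons_measure cons_measure_sigma_finite.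

End cons_measure.

Fixpoint lebesgue_tuple (R : realType) (d : nat) :
    {sigma_finite_measure set (d.-tuple (measurableTypeR R)) -> \bar R} :=
  match d with
  | 0 => \d_[tuple]
  | d'.+1 => cons_measure lebesgue_measure (lebesgue_tuple R d')
  end.

(** ** Periodic functions on a box

The domain is the periodic cell [prod_i ]a_i, a_i + L_i[ ]; functions on it with
periodic boundary conditions are functions on the whole of R^d that are
[L_i]-periodic in the i-th coordinate direction. Points and vectors of R^d are
row vectors. *)

Section domain.
Context {R : realType} {d : nat}.
Implicit Types (a L x u v : 'rV[R]_d) (f g : 'rV[R]_d -> R).

Definition point_of_tuple (t : d.-tuple (measurableTypeR R)) : 'rV[R]_d :=
  \row_i (tnth t i : R).

Definition cell a L : set (d.-tuple (measurableTypeR R)) :=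
  [set t | forall i, a 0 i < tnth t i < a 0 i + L 0 i].

Definition integral_cell a L f : R :=
  \int[lebesgue_tuple R d]_(t in cell a L) f (point_of_tuple t).

Definition integrable_cell a L f : Prop :=
  (lebesgue_tuple R d).-integrable (cell a L)
    (fun t => (f (point_of_tuple t))%:E).

Definition ae_cell a L (P : 'rV[R]_d -> Prop) : Prop :=
  {ae lebesgue_tuple R d, forall t, cell a L t -> P (point_of_tuple t)}.

Definition unit_vec (i : 'I_d) : 'rV[R]_d := delta_mx 0 i.

Definition cell_periodic L f : Prop :=
  forall i, periodic f (L 0 i *: unit_vec i).

Definition partial_derive i f x : R := 'D_(unit_vec i) f x.

Fixpoint class_C (k : nat) f : Prop :=
  continuous f /\
  match k with
  | 0 => True
  | k'.+1 => forall i, (forall x, derivable f x (unit_vec i)) /\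
                       class_C k' (partial_derive i f)
  end.

Definition grad f x : 'rV[R]_d := \row_i partial_derive i f x.

Definition divergence (V : 'rV[R]_d -> 'rV[R]_d) x : R :=
  \sum_i partial_derive i (fun y => V y 0 i) x.

Definition laplacian f : 'rV[R]_d -> R := divergence (grad f).

Definition dot u v : R := \sum_i u 0 i * v 0 i.

(* The library norm on row vectors is the sup norm. *)
Definition euclid u : R := Num.sqrt (dot u u).

Definition l2_inner a L f g : R := integral_cell a L (fun x => f x * g x).

Definition l2_sq a L f : R := l2_inner a L f f.

Definition l2_sq_vec a L (V : 'rV[R]_d -> 'rV[R]_d) : R :=
  integral_cell a L (fun x => euclid (V x) ^+ 2).

End domain.

(** ** Anisotropic energy

Since [0^-1 = 0], the normal [grad phi / |grad phi|] and [m_vec] are 0 where the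
gradient of [phi] vanishes. *)

Section anisotropy.
Context {R : realType} {d : nat}.
Variables (a L : 'rV[R]_d) (alpha eps C : R).
Implicit Types (x p : 'rV[R]_d) (phi : 'rV[R]_d -> R).

Definition unit_normal phi x : 'rV[R]_d := (euclid (grad phi x))^-1 *: grad phi x.

Definition gamma p : R := 1 + alpha * (4 * \sum_i p 0 i ^+ 4 - 3).

Definition double_well (s : R) : R := (s ^+ 2 - 1) ^+ 2 / 4.

Definition double_well' (s : R) : R := s * (s ^+ 2 - 1).

Definition energy_density phi x : R :=
  euclid (grad phi x) ^+ 2 / 2 + double_well (phi x) / eps ^+ 2.

(* [1 - n n^T] for the row vector [n]; it is symmetric, so that it may act on
   row vectors from the right. *)
Definition tangent_proj (n : 'rV[R]_d) : 'M[R]_d := 1%:M - n^T *m n.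

Definition m_vec phi x : 'rV[R]_d :=
  let n := unit_normal phi x in
  gamma n *: grad phi x +
  (energy_density phi x / euclid (grad phi x)) *:
    (grad gamma n *m tangent_proj n).

Definition radicand phi : R :=
  integral_cell a L (fun x => gamma (unit_normal phi x) * energy_density phi x) + C.

Definition H_fun phi x : R :=
  (gamma (unit_normal phi x) * double_well' (phi x) / eps ^+ 2
   - divergence (m_vec phi) x) / Num.sqrt (radicand phi).

End anisotropy.

(** ** Time discretization; all operators are used for [n >= 1] only *)

Section time.
Context {R : realType}.
Variables (theta tau : R).

Definition D_tau (u : nat -> R) (n : nat) : R :=
  ((theta + 2^-1) * u n.+1 - 2 * theta * u n + (theta - 2^-1) * u n.-1) / tau.

Definition at_theta (u : nat -> R) (n : nat) : R :=
  theta * u n.+1 + (1 - theta) * u n.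

Definition extrapolate (u : nat -> R) (n : nat) : R :=
  (1 + theta) * u n - theta * u n.-1.

Definition diff2 (u : nat -> R) (n : nat) : R := u n.+1 - 2 * u n + u n.-1.

(* The quadratic form of the G-norms in terms of [(u, u)], [(u, w)], [(w, w)]. *)
Definition G_form (uu uw ww : R) : R :=
  theta * (2 * theta + 3) / 2 * uu - (theta + 1) * (2 * theta - 1) * uw
  + theta * (2 * theta - 1) / 2 * ww.

Definition G_sq_real (u w : R) : R := G_form (u ^+ 2) (u * w) (w ^+ 2).

Definition G_sq_l2 d (a L : 'rV[R]_d) (u w : 'rV[R]_d -> R) : R :=
  G_form (l2_sq a L u) (l2_inner a L u w) (l2_sq a L w).

End time.

(** ** The U_L-method; [mu n] stands for [mu^{n+theta}] *)

Section scheme.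
Context {R : realType} {d : nat}.
Variables (a L : 'rV[R]_d) (alpha eps C theta tau beta S1 S2 : R) (M : R -> R).
Variables (phi : nat -> 'rV[R]_d -> R) (r : nat -> R) (mu : nat -> 'rV[R]_d -> R).

Definition phi_star n x : R := extrapolate theta (phi ^~ x) n.

Definition D_tau_phi n x : R := D_tau theta tau (phi ^~ x) n.

Definition phi_theta n x : R := at_theta theta (phi ^~ x) n.

Definition diff2_phi n x : R := diff2 (phi ^~ x) n.

Definition H_star n : 'rV[R]_d -> R := H_fun a L alpha eps C (phi_star n).

Definition M_star n x : R := M (phi_star n x).

(* The second equation is required almost everywhere: [H_star] involves the
   normal to [phi_star], which has no meaning where the gradient vanishes. *)
Definition UL_method : Prop :=
  forall n, (1 <= n)%N ->
  [/\ forall x, D_tau_phi n x =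
        divergence (fun y => M_star n y *: grad (mu n) y) x,
      ae_cell a L (fun x => mu n x =
        H_star n x * at_theta theta r n
        + beta * laplacian (laplacian (phi_theta n)) x
        + S1 / eps ^+ 2 * diff2_phi n x
        - S2 * laplacian (diff2_phi n) x)
    & D_tau theta tau r n =
        integral_cell a L (fun x => H_star n x * D_tau_phi n x) / 2 ].

(* Every derivative and integral in the scheme exists, in the classical sense
   except for [div m] (see above). *)
Definition UL_regular : Prop :=
  (forall n, class_C 4 (phi n)) /\
  forall n, (1 <= n)%N ->
  [/\ class_C 1 (mu n),
      forall i, class_C 1 (fun x => M_star n x * partial_derive i (mu n) x),
      ae_cell a L (fun x => forall i,
        derivable (fun y => m_vec alpha eps (phi_star n) y 0 i) x (unit_vec i))
    & integrable_cell a L (fun x => H_star n x * D_tau_phi n x) ].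

(* [E_L^n], to be used for [n >= 1]. *)
Definition energy_L n : R :=
  G_sq_real theta (r n) (r n.-1)
  + beta / 2 * G_sq_l2 theta a L (laplacian (phi n)) (laplacian (phi n.-1))
  + S1 / eps ^+ 2 * (l2_sq a L (fun x => phi n x - phi n.-1 x) / 2)
  + S2 * (l2_sq_vec a L (fun x => grad (phi n) x - grad (phi n.-1) x) / 2).

Definition dissipation n : R :=
  l2_sq_vec a L (fun x => Num.sqrt (M_star n x) *: grad (mu n) x).

End scheme.

(* Main.v *)
Require Import Defs.
From mathcomp Require Import all_boot all_order all_algebra.
From mathcomp Require Import all_classical all_reals all_analysis.
From mathcomp Require Import measurable_realfun ring lra.

(* Testing the first equation of the scheme with [mu] and the second one with
   [D_tau phi] gives, after integration by parts over the periodic cell,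
     - |sqrt(M) grad mu|^2 = 2 r^theta D_tau r + beta (lap phi^theta, lap D_tau phi)
         + S1/eps^2 (diff2 phi, D_tau phi) + S2 (grad diff2 phi, grad D_tau phi),
   the nonlinear term being absorbed by the equation for [r]. Each product on the
   right is a difference quotient of the matching part of the energy plus a
   nonnegative multiple of the square of a second difference. Integration by
   parts reduces, by Fubini, to the fundamental theorem of calculus along lines
   parallel to a coordinate axis. *)

Set Implicit Arguments.
Unset Strict Implicit.
Unset Printing Implicit Defensive.
Import Order.TTheory GRing.Theory Num.Theory.
Import numFieldNormedType.Exports.
Local Open Scope classical_set_scope.
Local Open Scope ring_scope.

(** * Measurability and boundedness of continuous functions on the cell *)

Section cell.
Context {R : realType} {d : nat}.
Implicit Types (a L x : 'rV[R]_d) (f g : 'rV[R]_d -> R).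

Lemma measurable_coord (i : 'I_d) (A : set R) : measurable A ->
  measurable [set t : d.-tuple (measurableTypeR R) | A (tnth t i)].
Proof.
by move=> mA; rewrite -[X in measurable X]setTI; exact: measurable_tnth.
Qed.

Lemma measurable_box (A : 'I_d -> set R) : (forall i, measurable (A i)) ->
  measurable [set t : d.-tuple (measurableTypeR R) | forall i, A i (tnth t i)].
Proof.
move=> mA; rewrite (_ : mkset _ = \bigcap_(i in [set: 'I_d])
    [set t : d.-tuple (measurableTypeR R) | A i (tnth t i)]); last first.
  by apply/seteqP; split => [t At i _|t At i]; exact: At.
apply: fin_bigcap_measurable => // i _; exact: measurable_coord.
Qed.

Lemma measurable_cell a L : measurable (cell a L).
Proof.
rewrite (_ : cell a L = [set t | forall i,
    `]a 0 i, a 0 i + L 0 i[%classic (tnth t i : R)]).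
  apply: (@measurable_box (fun i => `]a 0 i, a 0 i + L 0 i[%classic)) => i.
  exact: measurable_itv.
by apply/seteqP; split => t At i; have := At i; rewrite /= in_itv.
Qed.

(* Open sets of R^d are countable unions of boxes with rational data. *)
Lemma continuous_measurable_tuple f : continuous f ->
  measurable_fun setT (f \o @point_of_tuple R d).
Proof.
move=> cf; apply: (measurability (@RGenOpens.G R)).
  exact: RGenOpens.measurableE.
move=> _ [_ [x [y ->]] <-]; rewrite setTI.
have oU : open (f @^-1` `]x, y[).
  by apply: open_comp => [z _|]; [exact: cf|exact: interval_open].
pose box (c r : {ffun 'I_d -> rat}) : set 'rV[R]_d :=
  [set v | forall i, ball (ratr (c i) : R) (ratr (r i)) (v 0 i)].
pose good := [set cr | box cr.1 cr.2 `<=` f @^-1` `]x, y[].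
rewrite (_ : _ @^-1` _ = \bigcup_(cr in good)
    [set t | forall i, ball (ratr (cr.1 i) : R) (ratr (cr.2 i)) (tnth t i : R)]).
  rewrite bigcup_mkcond; apply: countable_bigcupT_measurable => //.
  move=> cr; case: ifPn => // _; apply: (@measurable_box
    (fun i => ball (ratr (cr.1 i) : R) (ratr (cr.2 i)))) => i.
  exact: measurable_ball.
apply/seteqP; split => [t fxy|t [cr crgood tcr]]; last first.
  by apply: (crgood (point_of_tuple t)) => i; rewrite mxE; exact: tcr.
have : nbhs (point_of_tuple t) (f @^-1` `]x, y[) by exact: open_nbhs_nbhs.
move=> [P Pnbhs Psub].
(* A neighbourhood of a row vector contains a product of neighbourhoods of its entries; a rational
   ball containing the [i]-th coordinate of [t] is chosen inside each factor. *)
have /choice[c] : forall i, exists cr : rat * rat,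
    let B := ball (ratr cr.1 : R) (ratr cr.2) in
    B (tnth t i) /\ B `<=` P 0 i.
  move=> i; have : (P 0 i)° (tnth t i : R) by have := Pnbhs 0 i; rewrite mxE.
  move/mem_set=> /(open_subball_rat (@open_interior _ _))[p [q [/set_mem h1 h2]]].
  by exists (p, q); split => //; apply: (subset_trans h2); exact: interior_subset.
move=> cP; exists ([ffun i => (c i).1], [ffun i => (c i).2]) => /=.
  move=> v vbox; apply: Psub => i j; rewrite ord1.
  by apply: (cP j).2; have := vbox j; rewrite !ffunE.
by move=> i; rewrite !ffunE; exact: (cP i).1.
Qed.

(** The closed box with the same faces is compact and contains the cell. *)
Lemma continuous_cell_bounded a L f : continuous f ->
  [bounded f (point_of_tuple t) | t in cell a L].
Proof.
move=> cf; have cK : compact [set v : 'rV[R]_d |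
    forall i, `[a 0 i, a 0 i + L 0 i]%classic (v ord0 i)].
  by apply: (@rV_compact _ _ (fun i => `[a 0 i, a 0 i + L 0 i]%classic)) => i;
    exact: segment_compact.
have /compact_bounded[M [Mr MB]] := continuous_compact
  (continuous_subspaceT cf) cK.
exists M; split => // B /MB fB t tcell; apply: fB.
exists (point_of_tuple t) => // i; rewrite mxE /= in_itv/=.
by have /andP[/ltW -> /ltW ->] := tcell i.
Qed.
End cell.

(** * Splitting off the first coordinate, and Fubini on the cell *)

Lemma cell_cons {R : realType} {n : nat} (a L : 'rV[R]_n.+1)
    (x : R) (t : n.-tuple (measurableTypeR R)) :
  cell a L (tuple_cons (x, t)) <->
  (`]a 0 ord0, a 0 ord0 + L 0 ord0[%classic x /\
   cell (\row_i a 0 (lift ord0 i)) (\row_i L 0 (lift ord0 i)) t).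
Proof.
split=> [axt|[ax at_ i]].
  split; first by have := axt ord0; rewrite /= in_itv.
  by move=> i; have := axt (lift ord0 i); rewrite !mxE tnthS.
case: (unliftP ord0 i) => [j ->|->]; last by move: ax; rewrite /= in_itv.
by have := at_ j; rewrite !mxE tnthS.
Qed.

Lemma preimage_cell_cons {R : realType} {n : nat} (a L : 'rV[R]_n.+1) :
  @tuple_cons _ (measurableTypeR R) n @^-1` cell a L =
  `]a 0 ord0, a 0 ord0 + L 0 ord0[%classic `*`
  cell (\row_i a 0 (lift ord0 i)) (\row_i L 0 (lift ord0 i)).
Proof. by apply/seteqP; split => -[x t] /=; rewrite cell_cons. Qed.

Lemma cell_finite_measure {R : realType} {d : nat} (a L : 'rV[R]_d) :
  (lebesgue_tuple R d (cell a L) < +oo)%E.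
Proof.
elim: d a L => [|n IH] a L.
  by rewrite /= diracE ltry.
(* In dimension [n.+1] the measure is by definition the image of the product measure under
   [tuple_cons], so the goal is convertible to one about the preimage. *)
change ((lebesgue_measure \x lebesgue_tuple R n)%E
  (@tuple_cons _ (measurableTypeR R) n @^-1` cell a L) < +oo)%E.
rewrite preimage_cell_cons product_measure1E//; last exact: measurable_cell.
have Ifin : lebesgue_measure `]a 0 ord0, a 0 ord0 + L 0 ord0[%classic \is a fin_num.
  by rewrite lebesgue_measure_itv/=; case: ifPn.
by apply: lte_mul_pinfty; [| |exact: IH].
Qed.

Lemma continuous_integrable_cell {R : realType} {d : nat} (a L : 'rV[R]_d)
    (f : 'rV[R]_d -> R) : continuous f -> integrable_cell a L f.
Proof.
move=> cf; apply: measurable_bounded_integrable.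
- exact: measurable_cell.
- exact: cell_finite_measure.
- by apply: measurable_funTS; exact: continuous_measurable_tuple.
- exact: continuous_cell_bounded.
Qed.

(** The row-vector counterpart of [tuple_cons]: [unlift ord0] is [None] exactly at the first
    index. *)
Definition row_cons {R : realType} {n : nat} (x : R) (v : 'rV[R]_n) : 'rV[R]_n.+1 :=
  \row_i oapp (v 0) x (unlift ord0 i).

Lemma point_of_tuple_cons {R : realType} {n : nat} (x : R)
    (t : n.-tuple (measurableTypeR R)) :
  point_of_tuple (tuple_cons (x, t)) = row_cons x (point_of_tuple t).
Proof.
apply/rowP => i; rewrite !mxE.
by case: (unliftP ord0 i) => [j ->|->] /=; rewrite ?mxE ?tnthS.
Qed.

Lemma continuous_row_cons {R : realType} {n : nat} (x : R) :
  continuous (@row_cons R n x).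
Proof.
move=> v A [P Pnbhs PA]; exists (fun _ j => P 0 (lift ord0 j)).
  move=> i j; rewrite ord1; have := Pnbhs 0 (lift ord0 j).
  by rewrite mxE liftK.
move=> w Pw; apply: PA => i j; rewrite ord1 mxE.
case: (unliftP ord0 j) => [k ->|->] /=; first exact: (Pw 0).
by have /nbhs_singleton := Pnbhs 0 ord0; rewrite mxE unlift_none.
Qed.

(** The integrability that Fubini requires: transported along [tuple_cons], the function is bounded
    and measurable on a set of finite product measure. *)
Lemma integrable_cell_cons {R : realType} {n : nat} (a L : 'rV[R]_n.+1)
    (f : 'rV[R]_n.+1 -> R) : continuous f ->
  (lebesgue_measure \x lebesgue_tuple R n)%E.-integrable
    (`]a 0 ord0, a 0 ord0 + L 0 ord0[%classic `*`
       cell (\row_i a 0 (lift ord0 i)) (\row_i L 0 (lift ord0 i)))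
    (fun p => (f (row_cons p.1 (point_of_tuple p.2)))%:E).
Proof.
move=> cf; rewrite -preimage_cell_cons.
have -> : (fun p : R * n.-tuple (measurableTypeR R) =>
    (f (row_cons p.1 (point_of_tuple p.2)))%:E) =
    EFin \o (f \o @point_of_tuple R n.+1 \o @tuple_cons _ (measurableTypeR R) n).
  by apply/funext => -[x t] /=; rewrite point_of_tuple_cons.
have mpre : measurable (@tuple_cons _ (measurableTypeR R) n @^-1` cell a L).
  rewrite -[X in measurable X]setTI; apply: measurable_tuple_cons => //.
  exact: measurable_cell.
apply: measurable_bounded_integrable => //.
- exact: (@cell_finite_measure R n.+1 a L).
- apply: measurable_funTS; apply: measurableT_comp; last exact: measurable_tuple_cons.
  exact: continuous_measurable_tuple.
- have [M [Mr MB]] := continuous_cell_bounded a L cf.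
  by exists M; split => // B /MB fB p pcell; exact: fB.
Qed.

(** Fubini in both orders. With the line integral innermost it handles the first coordinate
    direction; with the slice innermost it lets an induction on the dimension reach the other
    directions. *)
Lemma integral_cell_cons {R : realType} {n : nat} (a L : 'rV[R]_n.+1)
    (f : 'rV[R]_n.+1 -> R) : continuous f ->
  let I := `]a 0 ord0, a 0 ord0 + L 0 ord0[%classic in
  let Q := cell (\row_i a 0 (lift ord0 i)) (\row_i L 0 (lift ord0 i)) in
  integral_cell a L f = fine (\int[lebesgue_tuple R n]_(t in Q)
     \int[lebesgue_measure]_(x in I) (f (row_cons x (point_of_tuple t)))%:E)%E /\
  integral_cell a L f = fine (\int[lebesgue_measure]_(x in I)
     \int[lebesgue_tuple R n]_(t in Q) (f (row_cons x (point_of_tuple t)))%:E)%E.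
Proof.
move=> cf I Q; have intf := integrable_cell_cons a L cf.
rewrite -/I -/Q in intf.
have mQ : measurable Q by exact: measurable_cell.
have mI : measurable (I : set (measurableTypeR R)) by exact: measurable_itv.
have mIQ : measurable ((I : set (measurableTypeR R)) `*` Q) by exact: measurableX.
have E0 : (\int[lebesgue_tuple R n.+1]_(t in cell a L) (f (point_of_tuple t))%:E =
  \int[lebesgue_measure \x lebesgue_tuple R n]_(p in I `*` Q)
    (f (row_cons p.1 (point_of_tuple p.2)))%:E)%E.
  rewrite [LHS](@integral_pushforward _ _ _ _ _ _ (@measurable_tuple_cons _ _ n)
    (lebesgue_measure \x lebesgue_tuple R n)%E).
  - rewrite preimage_cell_cons; apply: eq_integral => -[x t] _ /=.
    by rewrite point_of_tuple_cons.
  - apply/measurable_EFinP; exact: (continuous_measurable_tuple cf).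
  - rewrite preimage_cell_cons; apply: eq_integrable intf => // -[x t] _ /=.
    by rewrite point_of_tuple_cons.
  - exact: measurable_cell.
(* Fubini is applied on the whole product space, so the integrand is extended by zero; by [gE] this
   extension can be made one variable at a time. *)
have := intf; rewrite integrable_mkcond// => intf'.
pose g (p : R * n.-tuple (measurableTypeR R)) := (f (row_cons p.1 (point_of_tuple p.2)))%:E.
have gE x t : ((g \_ (I `*` Q)) (x, t) =
    ((fun x => ((fun t => g (x, t)) \_ Q) t) \_ I) x)%E.
  by rewrite !patchE in_setX; case: (x \in I); case: (t \in Q).
split; rewrite /integral_cell /Rintegral E0 integral_mkcond -/g; congr fine.
  rewrite -integral21_prod_meas1// [RHS]integral_mkcond.
  apply: eq_integral => t _; rewrite /fubini_G.
  under eq_integral do rewrite gE.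
  rewrite -integral_mkcond patchE; case: ifPn => tQ.
    by apply: eq_integral => x _; rewrite patchE tQ.
  by apply: integral0_eq => x _; rewrite patchE (negbTE tQ).
rewrite -integral12_prod_meas1// [RHS]integral_mkcond.
apply: eq_integral => x _; rewrite /fubini_F.
under eq_integral do rewrite gE.
rewrite patchE; case: ifPn => xI.
  rewrite [RHS]integral_mkcond; apply: eq_integral => t _.
  by rewrite patchE xI.
by apply: integral0_eq => t _; rewrite patchE (negbTE xI).
Qed.

(** The point in the hypothesis is [v] with its [i]-th entry replaced by [s]. If [i] is the first
    index, the inner Fubini integral is such a line integral; otherwise every slice with fixed first
    coordinate inherits the hypothesis in one dimension less. *)
Lemma integral_cell_line0 {R : realType} {d : nat} (a L : 'rV[R]_d) (i : 'I_d)
    (f : 'rV[R]_d -> R) : continuous f ->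
  (forall v : 'rV[R]_d, (\int[lebesgue_measure]_(s in `](a 0 i)%R, (a 0 i + L 0 i)%R[)
     (f (v + (s - v 0 i) *: unit_vec i)%R)%:E)%E = 0%E) ->
  integral_cell a L f = 0.
Proof.
elim: d a L i f => [|n IH] a L i f cf fi0; first by case: i {fi0}.
have [f1 f2] := integral_cell_cons a L cf.
case: (unliftP ord0 i) fi0 => [j ->|->] fi0.
  rewrite f2 integral0_eq// => x _; set Q := cell _ _.
  have := @IH (\row_i a 0 (lift ord0 i)) (\row_i L 0 (lift ord0 i)) j
    (f \o row_cons x).
  rewrite /integral_cell /Rintegral => IHx.
  (* The induction hypothesis only gives that [fine] of the integral is 0, which would also hold at
     infinite values; integrability excludes these. *)
  suff /eqP : fine (\int[lebesgue_tuple R n]_(t in Q)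
      ((f \o row_cons x) (point_of_tuple t))%:E)%E = 0.
    rewrite fine_eq0; first by move/eqP.
    apply: integrable_fin_num; first exact: measurable_cell.
    apply: (@continuous_integrable_cell _ _ _ _ (f \o row_cons x)).
    by move=> v; apply: continuous_comp; [exact: continuous_row_cons|exact: cf].
  apply: IHx.
    by move=> v; apply: continuous_comp; [exact: continuous_row_cons|exact: cf].
  move=> v; rewrite -[RHS](fi0 (row_cons x v)) !mxE liftK/=.
  apply: eq_integral => s _; congr (f _)%:E; apply/rowP => k; rewrite !mxE.
  case: (unliftP ord0 k) => [l ->|->] /=; rewrite ?mxE ?(inj_eq lift_inj)//.
  by rewrite mulr0 addr0.
rewrite f1 integral0_eq// => t _.
(* The entry 0 is a placeholder, overwritten by [s]. *)
rewrite -[RHS](fi0 (row_cons 0 (point_of_tuple t))) !mxE unlift_none/=.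
apply: eq_integral => s _; congr (f _)%:E; apply/rowP => k; rewrite !mxE.
case: (unliftP ord0 k) => [l ->|->] /=; rewrite ?mxE ?eqxx/=.
  by rewrite mulr0 addr0.
by rewrite subr0 mulr1 add0r.
Qed.

(** * Arithmetic of continuous functions *)

Section continuous_arithmetic.
Context {R : realType} {d : nat}.
Implicit Types f g : 'rV[R]_d -> R.

Lemma continuousD_fun f g : continuous f -> continuous g ->
  continuous (fun x => f x + g x).
Proof. by move=> cf cg x; exact: (cvgD (cf x) (cg x)). Qed.

Lemma continuousB_fun f g : continuous f -> continuous g ->
  continuous (fun x => f x - g x).
Proof. by move=> cf cg x; exact: (cvgB (cf x) (cg x)). Qed.

Lemma continuousM_fun f g : continuous f -> continuous g ->
  continuous (fun x => f x * g x).
Proof. by move=> cf cg x; exact: (cvgM (cf x) (cg x)). Qed.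

Lemma continuousZ_fun (c : R) f : continuous f -> continuous (fun x => c * f x).
Proof. by move=> cf x; exact: (cvgM (cvg_cst c) (cf x)). Qed.

Lemma integrable_cellM (a L : 'rV[R]_d) f g : continuous f -> continuous g ->
  integrable_cell a L (fun x => f x * g x).
Proof.
by move=> cf cg; apply: continuous_integrable_cell; exact: continuousM_fun.
Qed.

End continuous_arithmetic.

(** * Linearity of the cell integral, and integration by parts in one direction *)

Section integral_cell_theory.
Context {R : realType} {d : nat}.
Variables (a L : 'rV[R]_d).
Implicit Types f g : 'rV[R]_d -> R.

Lemma integral_cellD f g : integrable_cell a L f -> integrable_cell a L g ->
  integral_cell a L (fun x => f x + g x) = integral_cell a L f + integral_cell a L g.
Proof. by move=> cf cg; rewrite /integral_cell RintegralD//; exact: measurable_cell. Qed.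

Lemma integral_cellB f g : integrable_cell a L f -> integrable_cell a L g ->
  integral_cell a L (fun x => f x - g x) = integral_cell a L f - integral_cell a L g.
Proof. by move=> cf cg; rewrite /integral_cell RintegralB//; exact: measurable_cell. Qed.

Lemma integral_cellZ (c : R) f : integrable_cell a L f ->
  integral_cell a L (fun x => c * f x) = c * integral_cell a L f.
Proof. by move=> cf; rewrite /integral_cell RintegralZl//; exact: measurable_cell. Qed.

Lemma integrable_cellD f g : integrable_cell a L f -> integrable_cell a L g ->
  integrable_cell a L (fun x => f x + g x).
Proof. move=> cf cg; have := integrableD (measurable_cell a L) cf cg; exact. Qed.

Lemma integrable_cellZ (c : R) f : integrable_cell a L f ->
  integrable_cell a L (fun x => c * f x).
Proof. move=> cf; have := integrableZl (measurable_cell a L) c cf; exact. Qed.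

Lemma integral_cell_le f g : integrable_cell a L f -> integrable_cell a L g ->
  (forall x, f x <= g x) -> integral_cell a L f <= integral_cell a L g.
Proof.
move=> cf cg fg; apply: le_Rintegral => //; exact: measurable_cell.
Qed.

Lemma integral_cell_ge0 f : (forall x, 0 <= f x) -> 0 <= integral_cell a L f.
Proof. by move=> f0; exact: Rintegral_ge0. Qed.

(** Meant for the second equation of the scheme, which holds only almost everywhere; integrability
    supplies the measurability of both sides. *)
Lemma eq_integral_cell_ae f g : integrable_cell a L f -> integrable_cell a L g ->
  ae_cell a L (fun x => f x = g x) -> integral_cell a L f = integral_cell a L g.
Proof.
move=> intf intg fg; congr fine; apply: ae_eq_integral.
- exact: measurable_cell.
- exact: measurable_int intf.
- exact: measurable_int intg.
- case: fg => N [mN N0 subN]; exists N; split => // t ntfg; apply: subN => /= fgt.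
  by apply: ntfg => tcell; rewrite fgt.
Qed.

(** The difference quotient of the restriction to the line equals the directional one of [f] as a
    function of the increment. *)
Lemma is_derive_line f (v : 'rV[R]_d) i (s : R) :
  (forall x, derivable f x (unit_vec i)) ->
  is_derive s 1 (fun s => f (v + (s - v 0 i) *: unit_vec i))
    (partial_derive i f (v + (s - v 0 i) *: unit_vec i)).
Proof.
move=> df; set y := v + _; set h := fun s => _.
have E : (fun k : R => k^-1 *: ((h \o shift s) (k *: (1 : R)) - h s)) =
    (fun k => k^-1 *: ((f \o shift y) (k *: unit_vec i) - f y)).
  apply/funext => k; congr (_ *: (_ - _)); rewrite /h /= /y; congr (f _).
  rewrite [k *: 1]mulr1 addrCA -scalerDl.
  by congr (_ + _ *: _); ring.
by split; [rewrite /derivable E; exact: df | rewrite /derive E].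
Qed.

(** On each line parallel to the [i]-th axis the fundamental theorem of calculus leaves the
    difference of [f] at two points one period apart. *)
Lemma integral_cell_partial_derive f i : 0 < L 0 i -> cell_periodic L f ->
  (forall x, derivable f x (unit_vec i)) -> continuous (partial_derive i f) ->
  integral_cell a L (partial_derive i f) = 0.
Proof.
move=> L0 fper df cdf; apply: (integral_cell_line0 (i := i)) => // v.
pose h s := partial_derive i f (v + (s - v 0 i) *: unit_vec i).
pose H s := f (v + (s - v 0 i) *: unit_vec i).
have dH (s : R) : is_derive s 1 H (h s) by exact: is_derive_line.
have ch : continuous h.
  move=> s; apply: continuous_comp; last exact: cdf.
  apply: cvgD; first exact: cvg_cst.
  by apply: cvgZl; apply: cvgB; [exact: cvg_id|exact: cvg_cst].
have cH : continuous H.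
  move=> s; apply: differentiable_continuous; apply/derivable1_diffP.
  by have [] := dH s.
have mh D : measurable_fun D (EFin \o h).
  by apply/measurable_EFinP; apply: measurable_funTS; exact: continuous_measurable_fun.
rewrite integral_itv_obnd_cbnd// integral_itv_bndo_bndc//.
rewrite (@continuous_FTC2 _ h H) ?ltrDl//.
- rewrite /H (_ : v + (a 0 i + L 0 i - v 0 i) *: unit_vec i =
    v + (a 0 i - v 0 i) *: unit_vec i + L 0 i *: unit_vec i); last first.
    by rewrite -[RHS]addrA -scalerDl; congr (_ + _ *: _); ring.
  by rewrite fper subee.
- exact: continuous_subspaceT.
- split.
  + by move=> s _; have [] := dH s.
  + by apply: cvg_at_right_filter; exact: cH.
  + by apply: cvg_at_left_filter; exact: cH.
- by move=> s _; rewrite derive1E; have [] := dH s.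
Qed.

Lemma partial_derive_periodic f i : cell_periodic L f ->
  cell_periodic L (partial_derive i f).
Proof.
move=> fper j u; rewrite /partial_derive /derive.
set g1 := fun h => h^-1 *: _; set g2 := fun h => h^-1 *: _.
suff -> : g1 = g2 by [].
by apply/funext => k; rewrite /g1 /g2 /= addrA !fper.
Qed.

(** The product of [f] and [g] is periodic, so its partial derivative integrates to 0; the Leibniz
    rule splits that integral. *)
Lemma integral_cell_by_parts f g i : 0 < L 0 i ->
  cell_periodic L f -> cell_periodic L g -> class_C 1 f -> class_C 1 g ->
  integral_cell a L (fun x => partial_derive i f x * g x) =
  - integral_cell a L (fun x => f x * partial_derive i g x).
Proof.
move=> L0 fper gper [cf /(_ i)[df [cdf _]]] [cg /(_ i)[dg [cdg _]]].
have E : partial_derive i (fun x => f x * g x) =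
    (fun x => partial_derive i f x * g x + f x * partial_derive i g x).
  apply/funext => x; rewrite /partial_derive.
  rewrite [LHS](@deriveM _ _ f g)// addrC; congr (_ + _).
  by rewrite [LHS]mulrC.
have c1 : continuous (fun x => partial_derive i f x * g x).
  exact: continuousM_fun.
have c2 : continuous (fun x => f x * partial_derive i g x).
  exact: continuousM_fun.
apply/eqP; rewrite -addr_eq0 -integral_cellD; last 2 first.
  exact: continuous_integrable_cell.
  exact: continuous_integrable_cell.
rewrite -E; apply/eqP; apply: integral_cell_partial_derive => //.
- by move=> j x; rewrite fper gper.
- by move=> x; exact: (derivableM (df x) (dg x)).
- by rewrite E; exact: continuousD_fun.
Qed.

End integral_cell_theory.

(** * Classes of continuously differentiable functions *)

Section class_C_theory.
Context {R : realType} {d : nat}.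
Implicit Types (f g : 'rV[R]_d -> R) (k : nat).

Lemma class_C_continuous k f : class_C k f -> continuous f.
Proof. by case: k => [|k] []. Qed.

Lemma class_CW k f : class_C k.+1 f -> class_C k f.
Proof.
elim: k f => [|k IH] f [cf df]; split => // i.
by have [dfi Cf] := df i; split => //; exact: IH.
Qed.

Lemma class_C_le k l f : (k <= l)%N -> class_C l f -> class_C k f.
Proof.
by move=> /subnK <-; elim: (l - k)%N => // m IH; rewrite addSn => /class_CW/IH.
Qed.

Lemma class_C_derivable k f i x : class_C k.+1 f -> derivable f x (unit_vec i).
Proof. by move=> [_ /(_ i)[]]. Qed.

Lemma class_C_partial_derive k f i : class_C k.+1 f -> class_C k (partial_derive i f).
Proof. by move=> [_ /(_ i)[]]. Qed.

Lemma partial_deriveD f g i : (forall x, derivable f x (unit_vec i)) ->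
  (forall x, derivable g x (unit_vec i)) ->
  partial_derive i (fun x => f x + g x) =
  (fun x => partial_derive i f x + partial_derive i g x).
Proof. by move=> df dg; apply/funext => x; exact: (deriveD (df x) (dg x)). Qed.

Lemma partial_deriveZ (c : R) f i : (forall x, derivable f x (unit_vec i)) ->
  partial_derive i (fun x => c * f x) = (fun x => c * partial_derive i f x).
Proof. by move=> df; apply/funext => x; exact: (deriveZ c (df x)). Qed.

Lemma class_CD k f g : class_C k f -> class_C k g -> class_C k (fun x => f x + g x).
Proof.
elim: k f g => [|k IH] f g [cf df] [cg dg]; split => //.
- exact: continuousD_fun.
- exact: continuousD_fun.
move=> i; have [dfi Cf] := df i; have [dgi Cg] := dg i; split.
  by move=> x; exact: (derivableD (dfi x) (dgi x)).
by rewrite partial_deriveD//; exact: IH.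
Qed.

Lemma class_CZ k (c : R) f : class_C k f -> class_C k (fun x => c * f x).
Proof.
elim: k f => [|k IH] f [cf df]; split => //.
- exact: continuousZ_fun.
- exact: continuousZ_fun.
move=> i; have [dfi Cf] := df i; split.
  by move=> x; exact: (derivableZ (k := c) (dfi x)).
by rewrite partial_deriveZ//; exact: IH.
Qed.

Lemma class_C0 k : class_C k (fun _ : 'rV[R]_d => 0 : R).
Proof.
have c0 : continuous (fun _ : 'rV[R]_d => 0 : R) by exact: (@cst_continuous _ _ 0).
elim: k => [|k IH]; split => // i; split; first by move=> x; exact: derivable_cst.
have -> // : partial_derive i (fun=> 0 : R) = fun=> 0.
by apply/funext => x; exact: derive_cst.
Qed.

Lemma class_C_sum k (I : Type) (s : seq I) (F : I -> 'rV[R]_d -> R) :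
  (forall i, class_C k (F i)) -> class_C k (fun x => \sum_(i <- s) F i x).
Proof.
move=> CF; elim: s => [|i s IH].
  by under eq_fun do rewrite big_nil; exact: class_C0.
by under eq_fun do rewrite big_cons; exact: class_CD.
Qed.

Lemma laplacianE f : laplacian f =
  (fun x => \sum_i partial_derive i (partial_derive i f) x).
Proof.
apply/funext => x; apply: eq_bigr => i _; congr (partial_derive i _ x).
by apply/funext => y; rewrite mxE.
Qed.

Lemma class_C_laplacian k f : class_C k.+2 f -> class_C k (laplacian f).
Proof.
move=> Cf; rewrite laplacianE; apply: class_C_sum => i.
by do 2 apply: class_C_partial_derive.
Qed.

(** Common shape of the time operators on three consecutive iterates, so that regularity,
    periodicity and spatial derivatives pass through all of them by the same lemmas. *)
Definition comb3 (c1 c2 c3 : R) (f1 f2 f3 : 'rV[R]_d -> R) (x : 'rV[R]_d) : R :=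
  c1 * f1 x + c2 * f2 x + c3 * f3 x.

Section comb3.
Variables (c1 c2 c3 : R).

Lemma class_C_comb3 k f1 f2 f3 : class_C k f1 -> class_C k f2 -> class_C k f3 ->
  class_C k (comb3 c1 c2 c3 f1 f2 f3).
Proof. by move=> C1 C2 C3; do 2 ?apply: class_CD; exact: class_CZ. Qed.

Lemma partial_derive_comb3 i f1 f2 f3 :
  class_C 1 f1 -> class_C 1 f2 -> class_C 1 f3 ->
  partial_derive i (comb3 c1 c2 c3 f1 f2 f3) =
  comb3 c1 c2 c3 (partial_derive i f1) (partial_derive i f2) (partial_derive i f3).
Proof.
move=> C1 C2 C3; have der f : class_C 1 f -> forall x, derivable f x (unit_vec i).
  by move=> Cf x; exact: class_C_derivable Cf.
have Z c f : class_C 1 f -> forall x, derivable (fun y => c * f y) x (unit_vec i).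
  by move=> Cf; apply: der; exact: class_CZ.
rewrite /comb3 partial_deriveD; [|apply: der|exact: Z]; last first.
  by apply: class_CD; exact: class_CZ.
rewrite partial_deriveD; [|exact: Z|exact: Z].
by rewrite !partial_deriveZ//; exact: der.
Qed.

Lemma laplacian_comb3 f1 f2 f3 : class_C 2 f1 -> class_C 2 f2 -> class_C 2 f3 ->
  laplacian (comb3 c1 c2 c3 f1 f2 f3) =
  comb3 c1 c2 c3 (laplacian f1) (laplacian f2) (laplacian f3).
Proof.
move=> C1 C2 C3; rewrite !laplacianE; apply/funext => x.
rewrite /comb3 !mulr_sumr -!big_split; apply: eq_bigr => i _ /=.
rewrite -/(comb3 c1 c2 c3 f1 f2 f3) partial_derive_comb3; try exact: class_CW.
by rewrite partial_derive_comb3//; exact: class_C_partial_derive.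
Qed.

End comb3.

Lemma laplacian_periodic (L : 'rV[R]_d) f : cell_periodic L f ->
  cell_periodic L (laplacian f).
Proof.
move=> fper j x; rewrite laplacianE; apply: eq_bigr => i _.
by do 2 apply: partial_derive_periodic.
Qed.

End class_C_theory.

(** * Divergence theorem and Green's identities for periodic functions *)

Section green.
Context {R : realType} {d : nat}.
Variables (a L : 'rV[R]_d).
Hypothesis L_gt0 : forall i, 0 < L 0 i.
Implicit Types f g : 'rV[R]_d -> R.

(** Both claims go through one induction, since additivity of the integral needs integrability of
    the tail. *)
Lemma integrable_cell_sum (I : Type) (s : seq I) (F : I -> 'rV[R]_d -> R) :
  (forall i, integrable_cell a L (F i)) ->
  integrable_cell a L (fun x => \sum_(i <- s) F i x) /\
  integral_cell a L (fun x => \sum_(i <- s) F i x) = \sum_(i <- s) integral_cell a L (F i).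
Proof.
move=> iF; elim: s => [|i s [IH1 IH2]].
  under eq_fun do rewrite big_nil; rewrite big_nil; split.
    by apply: continuous_integrable_cell; exact: (@cst_continuous _ _ 0).
  by rewrite /integral_cell /Rintegral integral0_eq.
under eq_fun do rewrite big_cons; rewrite big_cons; split.
  exact: integrable_cellD.
by rewrite integral_cellD// IH2.
Qed.

Lemma integral_cell_divergence (V : 'rV[R]_d -> 'rV[R]_d) g :
  (forall i, class_C 1 (fun x => V x 0 i)) ->
  (forall i, cell_periodic L (fun x => V x 0 i)) ->
  class_C 1 g -> cell_periodic L g ->
  integral_cell a L (fun x => divergence V x * g x) =
  - integral_cell a L (fun x => dot (V x) (grad g x)).
Proof.
move=> CV Vper Cg gper; rewrite /divergence /dot.
under eq_fun do rewrite mulr_suml.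
have cg := class_C_continuous Cg.
have i1 i : integrable_cell a L
    (fun x => partial_derive i (fun y => V y 0 i) x * g x).
  apply: integrable_cellM => //.
  exact: class_C_continuous (class_C_partial_derive i (CV i)).
have i2 i : integrable_cell a L (fun x => V x 0 i * grad g x 0 i).
  under eq_fun do rewrite mxE.
  apply: integrable_cellM; first exact: class_C_continuous (CV i).
  exact: class_C_continuous (class_C_partial_derive i Cg).
rewrite (integrable_cell_sum _ i1).2 (integrable_cell_sum _ i2).2 -sumrN.
apply: eq_bigr => i _; rewrite integral_cell_by_parts//; congr (- _).
by under [in RHS]eq_fun do rewrite mxE.
Qed.

Lemma grad_coordE f i : (fun x => grad f x 0 i) = partial_derive i f.
Proof. by apply/funext => x; rewrite mxE. Qed.

(** Green's first identity: the divergence theorem for the field [grad f]. *)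
Lemma integral_cell_laplacian f g : class_C 2 f -> cell_periodic L f ->
  class_C 1 g -> cell_periodic L g ->
  integral_cell a L (fun x => laplacian f x * g x) =
  - integral_cell a L (fun x => dot (grad f x) (grad g x)).
Proof.
move=> Cf fper Cg gper; apply: integral_cell_divergence => // i;
  rewrite grad_coordE.
- exact: class_C_partial_derive.
- exact: partial_derive_periodic.
Qed.

Lemma dotC (u v : 'rV[R]_d) : dot u v = dot v u.
Proof. by apply: eq_bigr => i _; rewrite mulrC. Qed.

(** Green's second identity: both sides reduce to the same symmetric Dirichlet form. *)
Lemma integral_cell_laplacianC f g : class_C 2 f -> cell_periodic L f ->
  class_C 2 g -> cell_periodic L g ->
  integral_cell a L (fun x => laplacian f x * g x) =
  integral_cell a L (fun x => f x * laplacian g x).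
Proof.
move=> Cf fper Cg gper.
have -> : (fun x => f x * laplacian g x) = (fun x => laplacian g x * f x).
  by apply/funext => x; rewrite mulrC.
rewrite (integral_cell_laplacian Cf fper (class_CW Cg) gper).
rewrite (integral_cell_laplacian Cg gper (class_CW Cf) fper).
by congr (- integral_cell a L _); apply/funext => x; rewrite dotC.
Qed.

End green.

(** * Pointwise inequalities for the time discretization *)

Section time_stepping.
Context {R : realType}.
Variables (theta tau : R).
Hypotheses (theta_ge : 1 / 2 <= theta) (tau_gt0 : 0 < tau).
Implicit Types u : nat -> R.

(* The defect is [theta (2 theta - 1) / (2 tau)] times the squared second
   difference. *)
Lemma G_sq_real_increment u n :
  1 / tau * (G_sq_real theta (u n.+2) (u n.+1) - G_sq_real theta (u n.+1) (u n))
  <= 2 * (at_theta theta u n.+1 * D_tau theta tau u n.+1).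
Proof.
have theta_ge' := theta_ge.
rewrite -subr_ge0 [X in 0 <= X](_ : _ = theta * (2 * theta - 1) / 2
    * (u n.+2 - 2 * u n.+1 + u n) ^+ 2 / tau).
  apply: divr_ge0; last exact: ltW.
  apply: mulr_ge0; last exact: sqr_ge0.
  by apply: divr_ge0 => //; apply: mulr_ge0; lra.
rewrite /G_sq_real /G_form /D_tau /at_theta /=; field.
by rewrite gt_eqF.
Qed.

(* The defect is [theta / tau] times the squared second difference. *)
Lemma sqr_diff_increment u n :
  1 / tau * ((u n.+2 - u n.+1) ^+ 2 / 2 - (u n.+1 - u n) ^+ 2 / 2)
  <= diff2 u n.+1 * D_tau theta tau u n.+1.
Proof.
have theta_ge' := theta_ge.
rewrite -subr_ge0 [X in 0 <= X](_ : _ = theta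
    * (u n.+2 - 2 * u n.+1 + u n) ^+ 2 / tau).
  apply: divr_ge0; last exact: ltW.
  by apply: mulr_ge0; [lra|exact: sqr_ge0].
rewrite /diff2 /D_tau /=; field.
by rewrite gt_eqF.
Qed.

End time_stepping.

(** * Time operators as three-term combinations, at index [n.+1] so that the predecessor is [n] *)

Section time_operators.
Context {R : realType} {d : nat}.
Variables (theta tau : R).
Implicit Types phi : nat -> 'rV[R]_d -> R.

Lemma D_tau_phiE phi n : D_tau_phi theta tau phi n.+1 =
  comb3 ((theta + 2^-1) / tau) (- (2 * theta) / tau) ((theta - 2^-1) / tau)
    (phi n.+2) (phi n.+1) (phi n).
Proof. by apply/funext => x; rewrite /D_tau_phi /D_tau /comb3 /=; ring. Qed.

(** The coefficient 0 pads the two-point average to the three-point shape. *)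
Lemma phi_thetaE phi n : phi_theta theta phi n.+1 =
  comb3 theta (1 - theta) 0 (phi n.+2) (phi n.+1) (phi n).
Proof. by apply/funext => x; rewrite /phi_theta /at_theta /comb3 /=; ring. Qed.

Lemma diff2_phiE phi n : diff2_phi phi n.+1 =
  comb3 1 (- 2) 1 (phi n.+2) (phi n.+1) (phi n).
Proof. by apply/funext => x; rewrite /diff2_phi /diff2 /comb3 /=; ring. Qed.

End time_operators.

(** * From pointwise inequalities to integrals *)

Section quadratic_forms.
Context {R : realType} {d : nat}.
Variables (a L : 'rV[R]_d).
Implicit Types u w : 'rV[R]_d -> R.

Lemma euclid_sqr (v : 'rV[R]_d) : euclid v ^+ 2 = dot v v.
Proof. by rewrite sqr_sqrtr//; apply: sumr_ge0 => i _; rewrite -expr2 sqr_ge0. Qed.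

(** [G_form] is linear in its three arguments, so it commutes with the integral; this brings
    estimates of the G-norm down to real numbers. *)
Lemma G_sq_l2E theta u w : continuous u -> continuous w ->
  G_sq_l2 theta a L u w =
  integral_cell a L (fun x => G_sq_real theta (u x) (w x)).
Proof.
move=> cu cw; rewrite /G_sq_l2 /G_sq_real /G_form /l2_sq /l2_inner.
rewrite integral_cellD; last 2 first.
- apply: (@integrable_cellD _ _ _ _ _ (fun x => - (_ * _))).
    by apply: integrable_cellZ; exact: integrable_cellM.
  under eq_fun do rewrite -mulNr.
  by apply: integrable_cellZ; exact: integrable_cellM.
- by apply: integrable_cellZ; exact: integrable_cellM.
rewrite integral_cellB; [|by apply: integrable_cellZ; exact: integrable_cellM..].
by rewrite !integral_cellZ//; exact: integrable_cellM.
Qed.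

Lemma integral_cell_increment_le (c : R) (f g h : 'rV[R]_d -> R) :
  continuous f -> continuous g ->
  continuous h -> (forall x, c * (f x - g x) <= h x) ->
  c * (integral_cell a L f - integral_cell a L g) <= integral_cell a L h.
Proof.
move=> cf cg ch fgh; rewrite -integral_cellB; try exact: continuous_integrable_cell.
have cfg : continuous (fun x => f x - g x).
  exact: continuousB_fun.
rewrite -integral_cellZ; last exact: continuous_integrable_cell.
apply: integral_cell_le => //; last exact: continuous_integrable_cell.
by apply: integrable_cellZ; exact: continuous_integrable_cell.
Qed.

End quadratic_forms.

(** The final bookkeeping, with [k] the inverse time step: [A], [B], [C], [D] stand for the four
    parts of the new energy, primed letters for the old one, [x] and [y] for the average and the
    difference quotient of [r], and [p], [q], [g] for the pairings with the difference quotient of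
    [phi]. Once the bounds are multiplied by the nonnegative weights, the claim is linear. *)
Lemma weighted_increments_le {R : realFieldType}
    (k b s1 s2 A A' B B' C C' D D' x y p q g : R) :
  0 <= b -> 0 <= s1 -> 0 <= s2 ->
  k * (A - A') <= 2 * (x * y) -> k * (B - B') <= 2 * p ->
  k * (C - C') <= q -> k * (D - D') <= - g ->
  k * (A + b / 2 * B + s1 * C + s2 * D - (A' + b / 2 * B' + s1 * C' + s2 * D'))
  <= x * (2 * y) + b * p + s1 * q + - s2 * g.
Proof.
move=> b0 s10 s20 hA /(ler_wpM2l b0) hB /(ler_wpM2l s10) hC /(ler_wpM2l s20) hD.
lra.
Qed.

(** * Energy increments for a general sequence of continuous functions *)

Section energy_increments.
Context {R : realType} {d : nat}.
Variables (a L : 'rV[R]_d) (theta tau : R).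
Hypotheses (theta_ge : 1 / 2 <= theta) (tau_gt0 : 0 < tau).

Let contG (f g : 'rV[R]_d -> R) : continuous f -> continuous g ->
  continuous (fun x => G_sq_real theta (f x) (g x)).
Proof.
move=> cf cg; have -> : (fun x => G_sq_real theta (f x) (g x)) = (fun x =>
    theta * (2 * theta + 3) / 2 * (f x * f x)
    - (theta + 1) * (2 * theta - 1) * (f x * g x)
    + theta * (2 * theta - 1) / 2 * (g x * g x)) by apply/funext => x.
exact: (continuousD_fun (continuousB_fun (continuousZ_fun (continuousM_fun cf cf)) (continuousZ_fun (continuousM_fun cf cg))) (continuousZ_fun (continuousM_fun cg cg))).
Qed.

Variable l : nat -> 'rV[R]_d -> R.
Hypothesis cl : forall n, continuous (l n).

Lemma continuous_comb3 (c1 c2 c3 : R) (f1 f2 f3 : 'rV[R]_d -> R) :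
  continuous f1 -> continuous f2 -> continuous f3 ->
  continuous (comb3 c1 c2 c3 f1 f2 f3).
Proof. by move=> C1 C2 C3; apply: continuousD_fun; [apply: continuousD_fun|]; exact: continuousZ_fun. Qed.

(** The real inequality [G_sq_real_increment] at every point, integrated; it will be applied to the
    Laplacians of the iterates. *)
Lemma G_increment_le n :
  1 / tau * (G_sq_l2 theta a L (l n.+2) (l n.+1) - G_sq_l2 theta a L (l n.+1) (l n))
  <= 2 * integral_cell a L (fun x =>
       phi_theta theta l n.+1 x * D_tau_phi theta tau l n.+1 x).
Proof.
have cwu : continuous (fun x =>
    phi_theta theta l n.+1 x * D_tau_phi theta tau l n.+1 x).
  by rewrite phi_thetaE D_tau_phiE; apply: continuousM_fun; exact: continuous_comb3.
rewrite -integral_cellZ; last exact: continuous_integrable_cell.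
rewrite !G_sq_l2E//; apply: integral_cell_increment_le;
  [exact: contG|exact: contG|exact: continuousZ_fun|].
by move=> x; exact: (G_sq_real_increment theta_ge tau_gt0 (l ^~ x)).
Qed.

(** Integrates [sqr_diff_increment]; it serves both the iterates and each of their partial
    derivatives. *)
Lemma l2_increment_le n :
  1 / tau * (l2_sq a L (fun x => l n.+2 x - l n.+1 x) / 2
             - l2_sq a L (fun x => l n.+1 x - l n x) / 2)
  <= integral_cell a L (fun x => diff2_phi l n.+1 x * D_tau_phi theta tau l n.+1 x).
Proof.
have cdd m : continuous (fun x => (l m.+1 x - l m x) * (l m.+1 x - l m x)).
  by apply: continuousM_fun; exact: continuousB_fun.
have E m : l2_sq a L (fun x => l m.+1 x - l m x) / 2 =
    integral_cell a L (fun x => 2^-1 * ((l m.+1 x - l m x) * (l m.+1 x - l m x))).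
  by rewrite integral_cellZ 1?mulrC//; exact: continuous_integrable_cell.
rewrite !E; apply: integral_cell_increment_le; [exact: continuousZ_fun|exact: continuousZ_fun| |].
  by rewrite diff2_phiE D_tau_phiE; apply: continuousM_fun; exact: continuous_comb3.
move=> x; have := sqr_diff_increment theta_ge tau_gt0 (l ^~ x) n.
by rewrite !expr2 ![_ / 2]mulrC.
Qed.

End energy_increments.

(** * Dissipation, bending and gradient terms of the scheme *)

Section energy_balance.
Context {R : realType} {d : nat}.
Variables (a L : 'rV[R]_d) (theta tau : R).
Hypotheses (L_gt0 : forall i, 0 < L 0 i) (theta_ge : 1 / 2 <= theta) (tau_gt0 : 0 < tau).

Lemma comb3_periodic c1 c2 c3 (f1 f2 f3 : 'rV[R]_d -> R) :
  cell_periodic L f1 -> cell_periodic L f2 -> cell_periodic L f3 ->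
  cell_periodic L (comb3 c1 c2 c3 f1 f2 f3).
Proof. by move=> p1 p2 p3 i x; rewrite /comb3 p1 p2 p3. Qed.

(** Nonnegativity of [M] makes the squared root equal to [M]. In this form the dissipation is what
    the divergence theorem yields for the flux tested with [mu]. *)
Lemma dissipationE (M : R -> R) (phi mu : nat -> 'rV[R]_d -> R) n :
  (forall s, 0 <= M s) ->
  dissipation a L theta M phi mu n = integral_cell a L (fun x =>
    dot (M_star theta M phi n x *: grad (mu n) x) (grad (mu n) x)).
Proof.
move=> M_ge0; apply: eq_Rintegral => t _; rewrite euclid_sqr.
apply: eq_bigr => i _; rewrite !mxE mulrACA -expr2 sqr_sqrtr ?mulrA//.
exact: M_ge0.
Qed.

Variable phi : nat -> 'rV[R]_d -> R.
Hypotheses (phi_C4 : forall n, class_C 4 (phi n))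
  (phi_per : forall n, cell_periodic L (phi n)).

Let C_phi k n : (k <= 4)%N -> class_C k (phi n).
Proof. by move=> k4; exact: class_C_le k4 (phi_C4 n). Qed.

Let C_u k n : (k <= 4)%N -> class_C k (D_tau_phi theta tau phi n.+1).
Proof. by move=> k4; rewrite D_tau_phiE; apply: class_C_comb3; exact: C_phi. Qed.

Let C_w k n : (k <= 4)%N -> class_C k (phi_theta theta phi n.+1).
Proof. by move=> k4; rewrite phi_thetaE; apply: class_C_comb3; exact: C_phi. Qed.

Let C_q k n : (k <= 4)%N -> class_C k (diff2_phi phi n.+1).
Proof. by move=> k4; rewrite diff2_phiE; apply: class_C_comb3; exact: C_phi. Qed.

Let per_u n : cell_periodic L (D_tau_phi theta tau phi n.+1).
Proof. by rewrite D_tau_phiE; exact: comb3_periodic. Qed.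

Let per_w n : cell_periodic L (phi_theta theta phi n.+1).
Proof. by rewrite phi_thetaE; exact: comb3_periodic. Qed.

Let per_q n : cell_periodic L (diff2_phi phi n.+1).
Proof. by rewrite diff2_phiE; exact: comb3_periodic. Qed.

Let cont_partial i n : continuous (partial_derive i (phi n)).
Proof.
by apply: (@class_C_continuous _ _ 3); exact: class_C_partial_derive.
Qed.

(** Green's second identity moves one Laplacian onto the difference quotient. The Laplacian commutes
    with the time operators, so [G_increment_le] applies to the sequence of Laplacians. *)
Lemma bending_increment_le n :
  1 / tau * (G_sq_l2 theta a L (laplacian (phi n.+2)) (laplacian (phi n.+1))
             - G_sq_l2 theta a L (laplacian (phi n.+1)) (laplacian (phi n)))
  <= 2 * integral_cell a L (fun x =>
       laplacian (laplacian (phi_theta theta phi n.+1)) x * D_tau_phi theta tau phi n.+1 x).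
Proof.
have cl m : continuous (laplacian (phi m)).
  by apply: (@class_C_continuous _ _ 0); apply: class_C_laplacian; exact: C_phi.
have C_Lw : class_C 2 (laplacian (phi_theta theta phi n.+1)).
  by apply: class_C_laplacian; exact: C_w.
have per_Lw := laplacian_periodic (per_w n).
rewrite (integral_cell_laplacianC a L_gt0 C_Lw per_Lw (@C_u 2 n isT) (per_u n)).
have -> : laplacian (phi_theta theta phi n.+1) =
    phi_theta theta (fun m => laplacian (phi m)) n.+1.
  by rewrite !phi_thetaE laplacian_comb3; [|exact: C_phi..].
have -> : laplacian (D_tau_phi theta tau phi n.+1) =
    D_tau_phi theta tau (fun m => laplacian (phi m)) n.+1.
  by rewrite !D_tau_phiE laplacian_comb3; [|exact: C_phi..].
exact: (G_increment_le a L theta_ge tau_gt0 cl n).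
Qed.

(** After Green's first identity both sides are sums over the coordinates, and [l2_increment_le]
    applies to each sequence of partial derivatives. *)
Lemma grad_increment_le n :
  1 / tau * (l2_sq_vec a L (fun x => grad (phi n.+2) x - grad (phi n.+1) x) / 2
             - l2_sq_vec a L (fun x => grad (phi n.+1) x - grad (phi n) x) / 2)
  <= - integral_cell a L (fun x =>
       laplacian (diff2_phi phi n.+1) x * D_tau_phi theta tau phi n.+1 x).
Proof.
rewrite (integral_cell_laplacian a L_gt0 (@C_q 2 n isT) (per_q n) (@C_u 1 n isT) (per_u n)).
rewrite opprK.
pose l i m := partial_derive i (phi m).
have cl i m : continuous (l i m) by exact: cont_partial.
have E m : l2_sq_vec a L (fun x => grad (phi m.+1) x - grad (phi m) x) =
    \sum_i l2_sq a L (fun x => l i m.+1 x - l i m x).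
  rewrite -(integrable_cell_sum _ _).2; last first.
    by move=> i; apply: integrable_cellM; exact: continuousB_fun.
  apply: eq_Rintegral => t _; rewrite euclid_sqr.
  by apply: eq_bigr => i _; rewrite !mxE.
have -> : integral_cell a L (fun x =>
    dot (grad (diff2_phi phi n.+1) x) (grad (D_tau_phi theta tau phi n.+1) x)) =
    \sum_i integral_cell a L (fun x =>
      diff2_phi (l i) n.+1 x * D_tau_phi theta tau (l i) n.+1 x).
  rewrite -(integrable_cell_sum _ _).2; last first.
    move=> i; rewrite diff2_phiE D_tau_phiE.
    by apply: integrable_cellM; exact: continuous_comb3.
  congr (integral_cell a L _); apply/funext => x; apply: eq_bigr => i _.
  rewrite !mxE !diff2_phiE !D_tau_phiE.
  rewrite (partial_derive_comb3 _ _ _ _ (@C_phi 1 n.+2 isT) (@C_phi 1 n.+1 isT) (@C_phi 1 n isT)).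
  by rewrite (partial_derive_comb3 _ _ _ _ (@C_phi 1 n.+2 isT) (@C_phi 1 n.+1 isT) (@C_phi 1 n isT)).
rewrite !E -mulrBl -sumrB mulr_suml mulr_sumr; apply: ler_sum => i _.
rewrite mulrBl; exact: l2_increment_le.
Qed.

End energy_balance.

Theorem theorem3p1 (R : realType) (d : nat) (hd : d = 2%N \/ d = 3%N)
  (a L : 'rV[R]_d) (hL : forall i, 0 < L ord0 i)
  (alpha eps C theta tau beta S1 S2 M0 : R) (M : R -> R)
  (halpha : 0 <= alpha) (heps : 0 < eps) (hC : 0 < C)
  (htheta : 1 / 2 <= theta <= 1) (htau : 0 < tau) (hbeta : 0 < beta)
  (hS1 : 0 < S1) (hS2 : 0 < S2)
  (hM0 : 0 < M0) (hM : forall s, M0 <= M s)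
  (phi : nat -> 'rV[R]_d -> R) (r : nat -> R) (mu : nat -> 'rV[R]_d -> R)
  (hphi_per : forall n, cell_periodic L (phi n))
  (hmu_per : forall n, (1 <= n)%N -> cell_periodic L (mu n))
  (hreg : UL_regular a L alpha eps C theta tau M phi mu)
  (hrad : forall n, (1 <= n)%N ->
    0 < radicand a L alpha eps C (phi_star theta phi n))
  (hscheme : UL_method a L alpha eps C theta tau beta S1 S2 M phi r mu) :
  forall n, (1 <= n)%N ->
    1 / tau * (energy_L a L eps theta beta S1 S2 phi r n.+1
               - energy_L a L eps theta beta S1 S2 phi r n)
      <= - dissipation a L theta M phi mu n
    /\ - dissipation a L theta M phi mu n <= 0.
Proof.
move=> [//|n] _; have [theta_ge _] := andP htheta.
have L_gt0 i : 0 < L 0 i := hL i.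
have M_ge0 s : 0 <= M s := le_trans (ltW hM0) (hM s).
have [phi_C4 /(_ n.+1 isT)[mu_C1 flux_C1 _ int_Hu]] := hreg.
have [mass_eq potential_eq r_eq] := hscheme n.+1 isT.
set u := D_tau_phi theta tau phi n.+1 in int_Hu mass_eq r_eq.
set H := H_star a L alpha eps C theta phi n.+1 in int_Hu potential_eq r_eq.
have phi_C k m : (k <= 4)%N -> class_C k (phi m).
  by move=> k4; exact: class_C_le k4 (phi_C4 m).
have cu : continuous u.
  by rewrite /u D_tau_phiE; apply: (@class_C_continuous _ _ 4); exact: class_C_comb3.
have cmu := class_C_continuous mu_C1.
have diss_ge0 : 0 <= dissipation a L theta M phi mu n.+1.
  by apply: integral_cell_ge0 => x; exact: sqr_ge0.
split; last by rewrite oppr_le0.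
have flux_power : integral_cell a L (fun x => mu n.+1 x * u x) =
    - dissipation a L theta M phi mu n.+1.
  rewrite dissipationE// -integral_cell_divergence//.
  - by congr integral_cell; apply/funext => x; rewrite mulrC -mass_eq.
  - by move=> i; under eq_fun do rewrite mxE mxE; exact: flux_C1.
  (* The flux is periodic: the mobility depends on space only through the extrapolation of periodic
     iterates. *)
  - move=> i j x; rewrite !mxE (partial_derive_periodic i (hmu_per n.+1 isT)).
    by rewrite /M_star /phi_star /extrapolate !hphi_per.
  - exact: hmu_per.
set LLw := laplacian (laplacian (phi_theta theta phi n.+1)) in potential_eq.
set q := diff2_phi phi n.+1 in potential_eq.
(* The bilaplacian uses up all four derivatives of the iterates. *)
have cLLw : continuous LLw.
  apply: (@class_C_continuous _ _ 0); do 2 apply: class_C_laplacian.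
  by rewrite phi_thetaE; exact: class_C_comb3.
have q_C4 : class_C 4 q by rewrite /q diff2_phiE; exact: class_C_comb3.
have cq := class_C_continuous q_C4.
have cLq : continuous (laplacian q).
  by apply: (@class_C_continuous _ _ 2); exact: class_C_laplacian.
have int_LLw := integrable_cellM a L cLLw cu.
have int_q := integrable_cellM a L cq cu.
have int_Lq := integrable_cellM a L cLq cu.
have energy_power : integral_cell a L (fun x => mu n.+1 x * u x) =
    at_theta theta r n.+1 * integral_cell a L (fun x => H x * u x)
    + beta * integral_cell a L (fun x => LLw x * u x)
    + S1 / eps ^+ 2 * integral_cell a L (fun x => q x * u x)
    + - S2 * integral_cell a L (fun x => laplacian q x * u x).
  (* Integrability of the product of [H] and [u] is taken from the regularity hypothesis; for the
     other products it follows from continuity. *)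
  rewrite -!integral_cellZ// -!integral_cellD//;
    do ?[exact: integrable_cellZ | apply: integrable_cellD].
  apply: eq_integral_cell_ae; first exact: integrable_cellM.
    by do ?[exact: integrable_cellZ | apply: integrable_cellD].
  case: potential_eq => N [mN N0 subN]; exists N; split => // t nt.
  apply: subN => /= mu_eq; apply: nt => tcell; rewrite mu_eq//; ring.
have r_le := G_sq_real_increment theta_ge htau r n.
have bend_le := bending_increment_le a L_gt0 theta_ge htau phi_C4 hphi_per n.
have l2_le := l2_increment_le a L theta_ge htau (fun m => class_C_continuous (phi_C4 m)) n.
have grad_le := grad_increment_le a L_gt0 theta_ge htau phi_C4 hphi_per n.
rewrite -/u -/LLw -/q in bend_le l2_le grad_le.
rewrite -flux_power energy_power.
(* The equation for [r] removes the nonlinear integral; its factor one half yields the 2 that [r_le]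
   expects. *)
have -> : integral_cell a L (fun x => H x * u x) = 2 * D_tau theta tau r n.+1.
  by rewrite r_eq mulrC divfK.
have S1eps_ge0 : 0 <= S1 / eps ^+ 2 by rewrite divr_ge0 ?sqr_ge0 ?ltW.
exact: weighted_increments_le (ltW hbeta) S1eps_ge0 (ltW hS2) r_le bend_le l2_le grad_le.
Qed.
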